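(* Let $\mathbf{X}=(X_1,\dots,X_n)\in L^1(\Omega,\mathcal{F},\mathbb{P})^n$ with $X_i\ge 0$, let $0<\beta_1<\cdots<\beta_n$ and $\lambda\ge 0$. Let $P(\lambda)$ be the set of minimizers of $$\sum_{i=1}^n\beta_i\,\mathbb{E}(R_i)+\lambda\,\mathrm{Var}\Big(\sum_{i=1}^n(X_i-R_i)\Big)$$ over all random vectors $\mathbf{R}=(R_1,\dots,R_n)$ with $0\le R_i\le X_i$ for all $i$ (this set has a single element). Then the single element $\mathbf{R}^*$ of $P(\lambda)$ has the following form: there is a constant $\sigma$ such that for all $1\le k\le n$, $$R_k^*=\Big(\sum_{i=k}^n X_i-\frac{\beta_k}{2\lambda}-\sigma\Big)_+\wedge X_k .$$
   Context: $(\Omega,\mathcal{F},\mathbb{P})$ is a probability space; random variables are identified when equal $\mathbb{P}$-almost surely, and relations between them hold $\mathbb{P}$-almost surely. The $R_i$ are arbitrary random variables on this space (not necessarily $\sigma(\mathbf{X})$-measurable). The variance takes values in $[0,\infty]$. Notation: $x_+=\max(x,0)$, $x\wedge y=\min(x,y)$. Conventions: $x/0=+\infty$ for $x\ge 0$, and $0\cdot\infty=0$. *)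

(* Defs.v *)
From mathcomp Require Export all_boot all_order all_algebra.
From mathcomp Require Export all_classical all_reals all_analysis.
Export Order.TTheory GRing.Theory Num.Theory.
Export numFieldNormedType.Exports.

Set Implicit Arguments.
Unset Strict Implicit.
Unset Printing Implicit Defensive.

Local Open Scope classical_set_scope.
Local Open Scope ring_scope.

Definition admissible {d : measure_display} {Omega : measurableType d}
    {R : realType} (P : probability Omega R) {n : nat}
    (X : 'I_n -> {RV P >-> R}) : set ('I_n -> {RV P >-> R}) :=
  [set r | forall i, {ae P, forall w, 0 <= r i w <= X i w}].

(* For integrable Y, 'V_P[Y] is the integral of the nonnegative function
   (Y - 'E_P[Y])^2, hence lies in [0, +oo] and is +oo when Y is not square
   integrable; the product of extended reals satisfies 0 * +oo = 0. *)
Definition objective {d : measure_display} {Omega : measurableType d}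
    {R : realType} (P : probability Omega R) {n : nat}
    (X : 'I_n -> {RV P >-> R}) (beta : 'I_n -> R) (lambda : R)
    (r : 'I_n -> {RV P >-> R}) : \bar R :=
  (\sum_(i < n) (beta i)%:E * 'E_P[r i]
   + lambda%:E * 'V_P[(fun w => \sum_(i < n) (X i w - r i w))%R])%E.

Definition minimizers {d : measure_display} {Omega : measurableType d}
    {R : realType} (P : probability Omega R) {n : nat}
    (X : 'I_n -> {RV P >-> R}) (beta : 'I_n -> R) (lambda : R) :
    set ('I_n -> {RV P >-> R}) :=
  [set r | admissible X r /\
     forall r', admissible X r' ->
       (objective X beta lambda r <= objective X beta lambda r')%E].

(* The right-hand side is an extended real because of the case lambda = 0:
   the inverse on \bar R satisfies 0^-1 = +oo, so that beta k / 0 = +oo for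
   beta k > 0. *)
Definition layer {d : measure_display} {Omega : measurableType d}
    {R : realType} (P : probability Omega R) {n : nat}
    (X : 'I_n -> {RV P >-> R}) (beta : 'I_n -> R) (lambda sigma : R)
    (k : 'I_n) (w : Omega) : \bar R :=
  mine (maxe ((\sum_(i < n | (k <= i)%N) X i w)%:E
              - (beta k)%:E / (2 * lambda)%:E - sigma%:E)%E 0%E)
       (X k w)%:E.

(* Main.v *)
From HB Require Import structures.
From mathcomp Require Import ring lra measurable_realfun.
Require Import Defs.

Set Implicit Arguments.
Unset Strict Implicit.
Unset Printing Implicit Defensive.

Local Open Scope classical_set_scope.
Local Open Scope ring_scope.

(** Put [b_i = beta_i / (2 lambda) + sigma] and let [Y] be the loss retained
    under the layered contract with deductibles [b_i].  For a fixed outcome the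
    layers stack so that risk [i] is fully ceded when [b_i < Y] and not ceded at
    all when [Y < b_i].  As [Y] is Lipschitz in [sigma] and lies between [0] and
    the total loss, the intermediate value theorem gives [sigma = E Y].

    For this [sigma], any competitor [r] with retained loss [Y'] costs, on
    average, [2 lambda sum_i (r_i - r*_i) (b_i - Y)
    + lambda (Y' - E Y' - (Y - E Y))^2] more than the layered contract [r*], and
    both terms are nonnegative.  If they vanish, [Y' - Y] is a constant [c], and
    [r_i = r*_i] wherever [Y <> b_i].  Were [c] nonzero, [Y] would almost surely
    be one of the [b_i], contradicting [E Y = sigma < b_i]; so [Y' = Y], and
    since the [b_i] are distinct, [r_i = r*_i] also where [Y = b_i].

    When [lambda = 0] every deductible is infinite and nothing is ceded. *)

(** * Layered cession for one fixed outcome *)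

Section PointwiseCession.
Variables (R : realType) (n : nat).
Implicit Types (x b f : 'I_n -> R).

(** The index is a [nat] so that [tail f k.+1] also makes sense at the last risk, where it is the
    empty sum. *)
Definition tail f (k : nat) : R := \sum_(i < n | (k <= i)%N) f i.

Definition cession x b (k : 'I_n) : R :=
  Num.min (Num.max (tail x k - b k) 0) (x k).

Definition retention x b : R := \sum_(i < n) (x i - cession x b i).

Lemma tail0 f : tail f 0 = \sum_(i < n) f i.
Proof. by []. Qed.

Lemma tail_oversize f (k : nat) : (n <= k)%N -> tail f k = 0.
Proof.
move=> nk; rewrite /tail big1// => i ki.
by have := leq_trans nk ki; rewrite leqNgt ltn_ord.
Qed.

Lemma tail_rec f (k : 'I_n) : tail f k = f k + tail f k.+1.
Proof.
rewrite /tail (bigD1 k)//=; congr (_ + _); apply: eq_bigl => i.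
by rewrite ltn_neqAle andbC eq_sym.
Qed.

(** Downward induction from [n], the direction in which [tail_rec] computes. *)
Lemma tail_ind (Q : nat -> Prop) : (forall k, (n <= k)%N -> Q k) ->
  (forall k : 'I_n, Q k.+1 -> Q k) -> forall k, Q k.
Proof.
move=> Q0 QS k; have [/Q0//|/ltnW kn] := leqP n k.
rewrite -(subKn kn); elim: (n - k)%N (leq_subr k n) => [_|m IH mn].
  by apply: Q0; rewrite subn0.
have lt_n : (n - m.+1 < n)%N by rewrite ltn_subrL/= (leq_trans _ mn).
by apply: (QS (Ordinal lt_n)) => /=; rewrite -subSn// subSS; apply/IH/ltnW.
Qed.

(** Kept one-sided: a two-sided estimate follows by exchanging [b] and [b']. *)
Lemma cession_lipschitz x b b' (e : R) k : 0 <= e -> b' k <= b k + e ->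
  cession x b k <= cession x b' k + e.
Proof.
move=> e0 bb; rewrite /cession [leRHS]addr_minl le_min; apply/andP; split.
  rewrite ge_min ge_max addr_maxl !le_max add0r e0 orbT andbT.
  by apply/orP; left; apply/orP; left; lra.
by rewrite ge_min [X in _ || X]lerDl e0 orbT.
Qed.

Lemma retention_lipschitz x b b' (e : R) : 0 <= e ->
  (forall i, b' i <= b i + e) -> retention x b' <= retention x b + n%:R * e.
Proof.
move=> e0 bb; rewrite /retention mulr_natl -[in e *+ _](card_ord n) -sumr_const.
rewrite -big_split/=; apply: ler_sum => i _.
have := cession_lipschitz x e0 (bb i); lra.
Qed.

Variables (x b : 'I_n -> R).
Hypothesis x_ge0 : forall i, 0 <= x i.
Hypothesis b_incr : forall i j : 'I_n, (i < j)%N -> b i < b j.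

(** [S k] and [T k] are the total and the retained loss over the risks from [k] on; [T 0] is the
    whole retention. *)
Let r := cession x b.
Let S := tail x.
Let T := tail (fun i => x i - r i).

Lemma cession_ge0 i : 0 <= cession x b i.
Proof. by rewrite /cession le_min le_max lexx orbT x_ge0. Qed.

Lemma cession_le i : cession x b i <= x i.
Proof. by rewrite /cession ge_min lexx orbT. Qed.

Lemma retention_ge0 : 0 <= retention x b.
Proof. by apply: sumr_ge0 => i _; rewrite subr_ge0 cession_le. Qed.

Lemma retention_le : retention x b <= \sum_i x i.
Proof. by apply: ler_sum => i _; rewrite gerBl cession_ge0. Qed.

Let T_le k : T k <= S k.
Proof. by apply: ler_sum => i _; rewrite gerBl cession_ge0. Qed.

Let S_rec (k : 'I_n) : S k = x k + S k.+1.
Proof. exact: tail_rec. Qed.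

Let T_rec (k : 'I_n) : T k = x k - r k + T k.+1.
Proof. exact: tail_rec. Qed.

(** This disjunction and the next one replace the min and max of [cession] by linear alternatives
    that [lra] can use. *)
Let cession_ge_or k : x k <= r k \/ S k - b k <= r k.
Proof.
rewrite /r /cession -/S.
have [_|_] := lerP _ (x k); last by left.
by right; rewrite le_max lexx.
Qed.

Let cession_le_or k : r k <= 0 \/ r k <= S k - b k.
Proof.
rewrite /r /cession -/S; have [_|_] := lerP (S k - b k) 0.
  by left; rewrite ge_min lexx.
by right; rewrite ge_min lexx.
Qed.

(** Passing from [m.+1] down to [m], either risk [m] is fully ceded and [T] does not grow, or
    [r m >= S m - b m], whence [T m <= b m + T m.+1 - S m.+1 <= b m <= c]. *)
Lemma tail_retention_le (k : 'I_n) (c : R) : T k <= c ->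
  (forall i : 'I_n, (i < k)%N -> b i <= c) -> T 0 <= c.
Proof.
move=> Tk bc; suff: forall m : nat, (m <= k)%N -> T m <= c by exact.
apply: tail_ind => [m nm mk|m IH].
  suff <- : k = m :> nat by [].
  by apply/eqP; rewrite eqn_leq mk (leq_trans _ nm)// ltnW.
rewrite leq_eqVlt => /predU1P[->//|mk].
have := IH mk; have := T_le m.+1; have := bc _ mk.
have := cession_ge_or m; rewrite T_rec S_rec.
by case; lra.
Qed.

(** Start [tail_retention_le] at the last risk, where [S] is just [x]. The bound does not depend on
    [x], which later makes the retained loss square integrable. *)
Lemma retention_le_bound (c : R) : 0 <= c ->
  (forall i, b i <= c) -> retention x b <= c.
Proof.
move=> c0 bc; have [n0|n0] := posnP n.
  by rewrite /retention -tail0 tail_oversize// n0.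
have ln : (n.-1 < n)%N by rewrite prednK.
rewrite /retention; change (T 0 <= c).
apply: (@tail_retention_le (Ordinal ln)) => //.
have := bc (Ordinal ln); have := cession_ge_or (Ordinal ln).
rewrite T_rec S_rec /= prednK// /S /T !tail_oversize//.
by case; lra.
Qed.

(** If risk [k] is not fully ceded, then [r k >= S k - b k] gives [T k <= b k]; the earlier
    deductibles are smaller, so the whole retention stays below [b k]. *)
Lemma cession_full (k : 'I_n) : b k < retention x b -> cession x b k = x k.
Proof.
apply: contraPP => /eqP rx; apply/negP; rewrite -leNgt.
have {rx} : r k < x k by rewrite lt_neqAle rx cession_le.
move=> rx; apply: (@tail_retention_le k); last by move=> i /b_incr/ltW.
have := cession_ge_or k; have := T_le k.+1; move: rx.
rewrite T_rec S_rec => rx Tk [|]; lra.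
Qed.

(** If something is ceded after [k], induction gives [T k.+1 >= b k.+1 > b k]. Otherwise risk [k]
    itself is ceded in part, so [r k <= S k - b k], which rearranges to [b k <= T k]. *)
Lemma tail_retention_ge (k : 'I_n) : T k < S k -> b k <= T k.
Proof.
suff: forall m : nat, forall k : 'I_n, k = m :> nat -> T k < S k -> b k <= T k.
  by apply.
apply: tail_ind => [m nm i im|m IH i im].
  by have := ltn_ord i; rewrite im ltnNge nm.
have {i im}-> : i = m by exact/val_inj.
have H : S m.+1 <= T m.+1 \/ b m <= T m.+1.
  have [mn|mn] := ltnP m.+1 n; last by left; rewrite /S /T !tail_oversize.
  have [|ST] := lerP (S m.+1) (T m.+1); first by left.
  right; apply: (@le_trans _ _ (b (Ordinal mn))).
    exact/ltW/b_incr/leqnn.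
  exact: (IH (Ordinal mn)).
move: H; have := cession_le m; have := cession_le_or m.
rewrite -/r T_rec S_rec.
by move=> [|] ? ? [|]; lra.
Qed.

(** Since [T k] is at most the retention, [tail_retention_ge] rules out any cession from [k] on. *)
Lemma cession_none (k : 'I_n) : retention x b < b k -> cession x b k = 0.
Proof.
move=> Tb; have Tk : T k <= retention x b.
  rewrite /retention (bigID (fun i : 'I_n => (k <= i)%N))/= lerDl.
  by apply: sumr_ge0 => i _; rewrite subr_ge0 cession_le.
have [ST|/tail_retention_ge bT] := lerP (S k) (T k); last first.
  by move: (le_lt_trans (le_trans bT Tk) Tb); rewrite ltxx.
apply/eqP; rewrite eq_le cession_ge0 andbT.
have [//|] := cession_le_or k.
rewrite -/r; lra.
Qed.

(** The first-order optimality condition: where [b k] differs from the retention, the cession sits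
    at the end of [[0, x k]] that makes the product nonnegative. *)
Lemma cession_slack (y : R) k : 0 <= y <= x k ->
  0 <= (y - cession x b k) * (b k - retention x b).
Proof.
move=> /andP[y0 yx].
have [bT|Tb|->] := ltrgtP (b k) (retention x b).
- by rewrite cession_full// mulr_le0// subr_le0// ltW.
- by rewrite cession_none// subr0 mulr_ge0// subr_ge0 ltW.
- by rewrite subrr mulr0.
Qed.

End PointwiseCession.

(** * Integrability and expectation under almost sure relations *)

Section AlmostEverywhere.
Context {d : measure_display} {T : measurableType d} {R : realType}.
Variable P : probability T R.
Implicit Types f g : T -> R.

Lemma Lfun1_measurable f : f \in Lfun P 1 -> measurable_fun setT f.
Proof. by move=> /Lfun1_integrable/measurable_int/measurable_EFinP. Qed.

Lemma Lfun1_ae_le f g : measurable_fun setT f -> g \in Lfun P 1 ->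
  {ae P, forall w, `|f w| <= g w} -> f \in Lfun P 1.
Proof.
move=> mf /Lfun1_integrable/integrableP[mg gfin] fg.
apply/Lfun1_integrable/integrableP; split; first exact/measurable_EFinP.
apply: le_lt_trans gfin; apply: ae_ge0_le_integral => //.
- by apply: measurableT_comp => //; exact/measurable_EFinP.
- exact: measurableT_comp.
- apply: filterS fg => w fg _ /=; rewrite lee_fin.
  exact/(le_trans fg)/ler_norm.
Qed.

Lemma expectation_ae_eq f g : measurable_fun setT f -> measurable_fun setT g ->
  {ae P, forall w, f w = g w} -> 'E_P[f]%E = 'E_P[g]%E.
Proof.
move=> mf mg fg; rewrite unlock; apply: ae_eq_integral => //.
- exact/measurable_EFinP.
- exact/measurable_EFinP.
- by apply: filterS fg => w -> _.
Qed.

Lemma expectation_ae_ge0 f : measurable_fun setT f ->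
  {ae P, forall w, 0 <= f w} -> (0 <= 'E_P[f])%E.
Proof.
(* The absolute value agrees with [f] almost surely and is nonnegative everywhere, as
   [expectation_ge0] demands. *)
move=> mf f0; rewrite (_ : 'E_P[f] = 'E_P[Num.norm \o f])%E.
  by apply: expectation_ge0 => w /=.
apply: expectation_ae_eq => //; first exact: measurableT_comp.
by apply: filterS f0 => w f0 /=; rewrite ger0_norm.
Qed.

Lemma expectation_ae_eq0 f : measurable_fun setT f ->
  {ae P, forall w, 0 <= f w} -> 'E_P[f]%E = 0%E ->
  {ae P, forall w, f w = 0}.
Proof.
move=> mf f0; rewrite (_ : 'E_P[f] = 'E_P[Num.norm \o f])%E; last first.
  apply: expectation_ae_eq => //; first exact: measurableT_comp.
  by apply: filterS f0 => w f0 /=; rewrite ger0_norm.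
rewrite unlock => /(@ae_eq_integral_abs _ _ _ P setT measurableT (EFin \o f)).
move/measurable_EFinP in mf; move=> /(_ mf).
by apply: filterS => w /(_ I) /= [].
Qed.

Lemma expectation_ge0_pinfty f : measurable_fun setT f ->
  (forall w, 0 <= f w) -> f \notin Lfun P 1 -> 'E_P[f]%E = +oo%E.
Proof.
move=> mf f0 /negP fL; apply/eqP; rewrite unlock -leye_eq leNgt.
apply/negP => foo; apply/fL/Lfun1_integrable/integrableP; split.
  exact/measurable_EFinP.
by under eq_integral do rewrite /= ger0_norm//.
Qed.

Lemma expectation_sum_ord n (f : 'I_n -> T -> R) :
  (forall i, f i \in Lfun P 1) ->
  ('E_P[fun w => (\sum_i f i w)%R] = \sum_i 'E_P[f i])%E.
Proof.
move=> fL; rewrite (_ : (fun w => _) = (\sum_(g <- map f (enum 'I_n)) g)%R).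
  rewrite expectation_sum ?big_map ?big_enum//.
  by move=> g /mapP[i _ ->].
by apply/funext => w; rewrite big_map big_enum/= fct_sumE.
Qed.

Lemma Lfun1_sum_ord n (f : 'I_n -> T -> R) : (forall i, f i \in Lfun P 1) ->
  (fun w => \sum_i f i w) \in Lfun P 1.
Proof.
move=> fL; rewrite (_ : (fun w => _) = \sum_i f i).
  by apply: rpred_sum => i _; exact: fL.
by apply/funext => w; rewrite fct_sumE.
Qed.

Lemma Lfun1D f g : f \in Lfun P 1 -> g \in Lfun P 1 ->
  (fun w => f w + g w) \in Lfun P 1.
Proof. exact: rpredD. Qed.

Lemma Lfun1B f g : f \in Lfun P 1 -> g \in Lfun P 1 ->
  (fun w => f w - g w) \in Lfun P 1.
Proof. exact: rpredB. Qed.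

Lemma Lfun1Z (k : R) f : f \in Lfun P 1 -> (fun w => k * f w) \in Lfun P 1.
Proof.
move=> fL; rewrite (_ : (fun w => _) = k \o* f); first exact: Lfun_scale.
by apply/funext => w /=; rewrite mulrC.
Qed.

Lemma Lfun1_cst (k : R) : (fun=> k) \in Lfun P 1.
Proof. exact: Lfun_cst. Qed.

(** Real-valued, so that [ring] and [lra] apply; [fine] sends an infinite expectation to 0. *)
Definition mean f : R := fine 'E_P[f].

Lemma meanK f : f \in Lfun P 1 -> (mean f)%:E = 'E_P[f]%E.
Proof. by move=> fL; rewrite fineK// expectation_fin_num. Qed.

Lemma meanD f g : f \in Lfun P 1 -> g \in Lfun P 1 ->
  mean (fun w => f w + g w) = mean f + mean g.
Proof.
by move=> fL gL; rewrite /mean expectationD// fineD// expectation_fin_num.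
Qed.

Lemma meanB f g : f \in Lfun P 1 -> g \in Lfun P 1 ->
  mean (fun w => f w - g w) = mean f - mean g.
Proof.
by move=> fL gL; rewrite /mean expectationB// fineB// expectation_fin_num.
Qed.

Lemma meanZ (k : R) f : f \in Lfun P 1 -> mean (fun w => k * f w) = k * mean f.
Proof.
move=> fL; rewrite /mean (_ : (fun w => _) = k \o* f)%R.
  by rewrite expectationZl// fineM// expectation_fin_num.
by apply/funext => w /=; rewrite mulrC.
Qed.

Lemma mean_cst (k : R) : mean (fun=> k) = k.
Proof. by rewrite /mean expectation_cst. Qed.

Lemma mean_ae_ge0 f : measurable_fun setT f ->
  {ae P, forall w, 0 <= f w} -> 0 <= mean f.
Proof. by move=> mf f0; exact/fine_ge0/expectation_ae_ge0. Qed.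

Lemma mean_ae_le f g : f \in Lfun P 1 -> g \in Lfun P 1 ->
  {ae P, forall w, f w <= g w} -> mean f <= mean g.
Proof.
move=> fL gL fg; rewrite -subr_ge0 -meanB//; apply: mean_ae_ge0.
  exact/Lfun1_measurable/Lfun1B.
by apply: filterS fg => w; rewrite subr_ge0.
Qed.

End AlmostEverywhere.

(** * The cession as a random variable, and the fixed point defining [sigma] *)

Section RandomCession.
Context {d : measure_display} {T : measurableType d} {R : realType}.
Variables (P : probability T R) (n : nat) (X : 'I_n -> {RV P >-> R}).

Lemma measurable_tail k : measurable_fun setT (fun w => tail (X ^~ w) k).
Proof.
pose f (i : 'I_n) (w : T) := if (k <= i)%N then X i w else 0.
rewrite (_ : (fun w => _) = (fun w => \sum_i f i w)).
  by apply: measurable_sum => i; rewrite /f; case: (leqP k i).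
by apply/funext => w; exact: big_mkcond.
Qed.

Lemma measurable_cession b k :
  measurable_fun setT (fun w => cession (X ^~ w) b k).
Proof.
apply: measurable_minr => //; apply: measurable_maxr => //.
by apply: measurable_funB => //; exact: measurable_tail.
Qed.

Definition cession_rv b k (w : T) : R := cession (X ^~ w) b k.

HB.instance Definition _ b k :=
  @isMeasurableFun.Build _ _ _ _ (cession_rv b k) (measurable_cession b k).


Definition retention_rv b (w : T) : R := retention (X ^~ w) b.

Hypothesis X_L1 : forall i, (X i : T -> R) \in Lfun P 1.
Hypothesis X_ge0 : forall i, {ae P, forall w, 0 <= X i w}.

Let X_ae_ge0 : {ae P, forall w, forall i, 0 <= X i w}.
Proof. exact: filter_forall. Qed.

Lemma measurable_retention b : measurable_fun setT (retention_rv b).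
Proof.
apply: measurable_sum => i; apply: measurable_funB => //.
exact: measurable_cession.
Qed.

Lemma Lfun1_retention b : retention_rv b \in Lfun P 1.
Proof.
apply: (@Lfun1_ae_le _ _ _ _ _ (fun w => \sum_i X i w)).
- exact: measurable_retention.
- exact: Lfun1_sum_ord.
- apply: filterS X_ae_ge0 => w X0; rewrite ger0_norm ?retention_ge0//.
  exact: retention_le.
Qed.

Lemma mean_retention_lipschitz c (s t : R) :
  `|mean P (retention_rv (fun i => c i + s)) -
    mean P (retention_rv (fun i => c i + t))| <= n%:R * `|s - t|.
Proof.
wlog suff H : s t / mean P (retention_rv (fun i => c i + s)) <=
    mean P (retention_rv (fun i => c i + t)) + n%:R * `|s - t|.
  by rewrite ler_distlC lerBlDr H distrC H.
rewrite -[n%:R * _](mean_cst P) -meanD ?Lfun1_cst ?Lfun1_retention//.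
apply: mean_ae_le; rewrite ?Lfun1D ?Lfun1_cst ?Lfun1_retention//.
apply: aeW => w; apply: retention_lipschitz => // i.
by rewrite -addrA lerD2l -lerBlDl ler_norm.
Qed.

Lemma mean_retention_fixpoint c :
  exists2 s : R, 0 <= s & mean P (retention_rv (fun i => c i + s)) = s.
Proof.
pose g (s : R) := mean P (retention_rv (fun i => c i + s)) - s.
(* The mean total loss bounds every mean retained loss, so [g] is nonpositive at [M]. *)
pose M := mean P (fun w => \sum_i X i w).
have M0 : 0 <= M.
  apply: mean_ae_ge0; first exact: measurable_sum.
  by apply: filterS X_ae_ge0 => w X0; exact: sumr_ge0.
have g0 : 0 <= g 0.
  rewrite /g subr0; apply: mean_ae_ge0; first exact: measurable_retention.
  by apply: filterS X_ae_ge0 => w X0; exact: retention_ge0.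
have gM : g M <= 0.
  rewrite /g subr_le0; apply: mean_ae_le; rewrite ?Lfun1_retention//.
    exact: Lfun1_sum_ord.
  by apply: filterS X_ae_ge0 => w X0; exact: retention_le.
have cg : continuous g.
  move=> s; apply: cvgB; last exact: cvg_id.
  apply/cvgrPdist_lt => e e0; near=> t.
  apply: le_lt_trans (mean_retention_lipschitz _ _ _) _.
  (* [n.+1] instead of [n] keeps the divisor of [e] positive even when [n] is 0. *)
  apply: (@le_lt_trans _ _ (n.+1%:R * `|s - t|)).
    by rewrite ler_wpM2r// ler_nat.
  rewrite mulrC -ltr_pdivlMr//; near: t.
  apply: (@cvgr_dist_lt _ _ _ (nbhs s) _ id); first exact: cvg_id.
  by rewrite divr_gt0.
have [||s] := @IVT R g 0 M 0 M0.
- exact: continuous_subspaceT.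
- by rewrite ge_min gM orbT le_max g0.
- rewrite in_itv/= => /andP[s0 _] /eqP; rewrite subr_eq0 => /eqP gs.
  by exists s.
Unshelve. all: by end_near. Qed.

End RandomCession.

(** * The objective as the mean of a pointwise cost *)

Section Objective.
Context {d : measure_display} {T : measurableType d} {R : realType}.
Variables (P : probability T R) (n : nat) (X : 'I_n -> {RV P >-> R}).
Variables (beta : 'I_n -> R) (lambda : R).
Hypothesis X_L1 : forall i, (X i : T -> R) \in Lfun P 1.
Implicit Types r : 'I_n -> {RV P >-> R}.

Definition loss r (w : T) : R := \sum_i (X i w - r i w).

Definition sqdev (Y : T -> R) (w : T) : R := (Y w - mean P Y) ^+ 2.

(** The integrand of the objective, which lets two contracts be compared outcome by outcome. *)
Definition cost r (w : T) : R :=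
  \sum_i beta i * r i w + lambda * sqdev (loss r) w.

Lemma admissible_Lfun1 r i : admissible X r -> (r i : T -> R) \in Lfun P 1.
Proof.
move=> adr; apply: Lfun1_ae_le (X_L1 i) _ => //.
by apply: filterS (adr i) => w /andP[r0 rX]; rewrite ger0_norm.
Qed.

Lemma loss_Lfun1 r : admissible X r -> loss r \in Lfun P 1.
Proof.
by move=> adr; apply: Lfun1_sum_ord => i; apply/Lfun1B/admissible_Lfun1.
Qed.

(** Valid for every [Y]: the variance is itself centred at the [fine] part of the expectation, as
    [sqdev] is. *)
Lemma varianceE_sqdev (Y : T -> R) : 'V_P[Y] = 'E_P[sqdev Y]%E.
Proof.
by rewrite /variance covariance.unlock; congr expectation; apply/funext.
Qed.

Lemma measurable_loss r : measurable_fun setT (loss r).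
Proof. by apply: measurable_sum => i; exact: measurable_funB. Qed.

Lemma measurable_sqdev Y : measurable_fun setT Y ->
  measurable_fun setT (sqdev Y).
Proof. by move=> mY; apply: measurable_funX; exact: measurable_funB. Qed.

Lemma premium_Lfun1 r : admissible X r ->
  (fun w => \sum_i beta i * r i w) \in Lfun P 1.
Proof.
by move=> adr; apply: Lfun1_sum_ord => i; apply/Lfun1Z/admissible_Lfun1.
Qed.

Lemma premiumE r : admissible X r ->
  (\sum_(i < n) (beta i)%:E * 'E_P[r i])%E =
  (mean P (fun w => \sum_i beta i * r i w)%R)%:E.
Proof.
move=> adr; rewrite meanK ?premium_Lfun1// expectation_sum_ord.
  apply: eq_bigr => i _.
  rewrite -[RHS]meanK; last exact/Lfun1Z/admissible_Lfun1.
  by rewrite meanZ ?admissible_Lfun1// EFinM meanK// admissible_Lfun1.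
by move=> i; exact/Lfun1Z/admissible_Lfun1.
Qed.

Lemma cost_Lfun1 r : admissible X r -> sqdev (loss r) \in Lfun P 1 ->
  cost r \in Lfun P 1.
Proof.
by move=> adr sqL; apply: Lfun1D; [exact: premium_Lfun1|exact: Lfun1Z].
Qed.

Lemma objectiveE r : admissible X r -> sqdev (loss r) \in Lfun P 1 ->
  objective X beta lambda r = (mean P (cost r))%:E.
Proof.
move=> adr sqL; rewrite /objective premiumE// varianceE_sqdev -meanK//.
by rewrite -EFinM -EFinD meanD ?premium_Lfun1 ?Lfun1Z// meanZ.
Qed.

Lemma objective_pinfty r : 0 < lambda -> admissible X r ->
  sqdev (loss r) \notin Lfun P 1 -> objective X beta lambda r = +oo%E.
Proof.
move=> l0 adr sqL; rewrite /objective premiumE// varianceE_sqdev.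
rewrite expectation_ge0_pinfty//.
- by rewrite gt0_muley ?lte_fin.
- exact/measurable_sqdev/measurable_loss.
- by move=> w; exact: sqr_ge0.
Qed.

Lemma objective_ae_eq r r' : (forall i, {ae P, forall w, r i w = r' i w}) ->
  objective X beta lambda r = objective X beta lambda r'.
Proof.
move=> rr; have lrr : {ae P, forall w, loss r w = loss r' w}.
  apply: filterS (filter_forall _ rr) => w rrw.
  by apply: eq_bigr => i _; rewrite rrw.
rewrite /objective; congr (_ + _ * _)%E.
  by apply: eq_bigr => i _; congr (_ * _)%E; exact: expectation_ae_eq.
(* Both losses get centred at the same constant, so that their squared deviations agree wherever the
   losses do. *)
rewrite !varianceE_sqdev; have -> : sqdev (loss r') =
    (fun w => (loss r' w - mean P (loss r)) ^+ 2).
  rewrite /sqdev /mean (_ : 'E_P[loss r'] = 'E_P[loss r])%E//.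
  apply: expectation_ae_eq; try exact: measurable_loss.
  by apply: filterS lrr => w ->.
apply: expectation_ae_eq.
- exact/measurable_sqdev/measurable_loss.
- by apply/measurable_funX/measurable_funB => //; exact: measurable_loss.
- by apply: filterS lrr => w lw; rewrite /sqdev -/(loss r w) lw.
Qed.

Lemma admissible_ae_eq r r' : (forall i, {ae P, forall w, r i w = r' i w}) ->
  admissible X r' -> admissible X r.
Proof. by move=> rr adr i; apply: filterS2 (rr i) (adr i) => w ->. Qed.

End Objective.

(** * Optimality and uniqueness for positive [lambda] *)

Section Optimality.
Context {d : measure_display} {T : measurableType d} {R : realType}.
Variables (P : probability T R) (n : nat) (X : 'I_n -> {RV P >-> R}).
Variables (beta : 'I_n -> R) (lambda sigma : R).
Hypothesis n_gt0 : (0 < n)%N.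
Hypothesis X_L1 : forall i, (X i : T -> R) \in Lfun P 1.
Hypothesis X_ge0 : forall i, {ae P, forall w, 0 <= X i w}.
Hypothesis beta_gt0 : forall i, 0 < beta i.
Hypothesis beta_incr : forall i j : 'I_n, (i < j)%N -> beta i < beta j.
Hypothesis lambda_gt0 : 0 < lambda.
Hypothesis sigma_ge0 : 0 <= sigma.

Let b i := beta i / (2 * lambda) + sigma.
Let rs i : {RV P >-> R} := cession_rv X b i.

Hypothesis sigmaE : mean P (loss X rs) = sigma.

Let b_incr (i j : 'I_n) : (i < j)%N -> b i < b j.
Proof.
by move=> ij; rewrite ltrD2r ltr_pM2r ?beta_incr// invr_gt0 mulr_gt0.
Qed.

Let lt_sigma_b i : sigma < b i.
Proof. by rewrite ltrDr divr_gt0// mulr_gt0. Qed.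

Let betaE i : beta i = 2 * lambda * (b i - sigma).
Proof. by rewrite addrK mulrC divfK// mulf_neq0// gt_eqF. Qed.

Let rs_adm : admissible X rs.
Proof.
move=> i; apply: filterS (filter_forall _ X_ge0) => w X0.
by rewrite cession_ge0// cession_le.
Qed.

Let Y := loss X rs.

Let rs_sqdev : sqdev P Y \in Lfun P 1.
Proof.
(* A crude common bound for all the deductibles, hence for [Y]. *)
pose c := \sum_i `|b i|.
apply: (@Lfun1_ae_le _ _ _ _ _ (fun=> (c + sigma) ^+ 2)).
- exact/measurable_sqdev/measurable_loss.
- exact: Lfun1_cst.
apply: filterS (filter_forall _ X_ge0) => w X0.
rewrite /sqdev sigmaE normrX lerXn2r ?nnegrE//.
  by rewrite addr_ge0// sumr_ge0.
have Y0 : 0 <= Y w by exact: retention_ge0.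
have Yc : Y w <= c.
  apply: (retention_le_bound X0); first exact: sumr_ge0.
  move=> i; rewrite /c (bigD1 i)//= -[leLHS]addr0 lerD ?ler_norm//.
  exact: sumr_ge0.
by rewrite (le_trans (ler_normB _ _))// !ger0_norm// lerD2r.
Qed.

Let slack (r : 'I_n -> {RV P >-> R}) i w : R := (r i w - rs i w) * (b i - Y w).

(** The excess cost of [r] over [rs], up to a term of mean zero, written as a sum of nonnegative
    parts. *)
Let gap (r : 'I_n -> {RV P >-> R}) w : R := 2 * lambda * \sum_i slack r i w +
  lambda * (loss X r w - mean P (loss X r) - (Y w - sigma)) ^+ 2.

(** Substitute [beta i = 2 * lambda * (b i - sigma)] and expand the squares. The correction is a
    constant times [Y - sigma], whose mean vanishes by [sigmaE]. *)
Let gapE (r : 'I_n -> {RV P >-> R}) :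
  gap r = fun w => (cost X beta lambda r w - cost X beta lambda rs w) +
    2 * lambda * (mean P (loss X r) - sigma) * (Y w - sigma).
Proof.
apply/funext => w.
have lossD : loss X r w = Y w - \sum_i (r i w - rs i w).
  by rewrite /Y /loss -sumrB; apply: eq_bigr => i _; ring.
have premD : \sum_i beta i * r i w = \sum_i beta i * rs i w +
    \sum_i beta i * (r i w - rs i w).
  by rewrite -big_split/=; apply: eq_bigr => i _; ring.
have slackE : 2 * lambda * \sum_i slack r i w =
    \sum_i beta i * (r i w - rs i w) -
    2 * lambda * (Y w - sigma) * \sum_i (r i w - rs i w).
  rewrite !mulr_sumr -sumrB; apply: eq_bigr => i _.
  by rewrite /slack betaE; ring.
rewrite /gap /cost premD slackE /sqdev -/Y sigmaE lossD; ring.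
Qed.

Let slack_ae_ge0 r : admissible X r ->
  {ae P, forall w, forall i, 0 <= slack r i w}.
Proof.
move=> adr; apply: filterS2 (filter_forall _ X_ge0) (filter_forall _ adr) => w.
by move=> X0 adw i; exact: cession_slack.
Qed.

Let gap_ae_ge0 r : admissible X r -> {ae P, forall w, 0 <= gap r w}.
Proof.
move=> adr; apply: filterS (slack_ae_ge0 adr) => w s0.
have l0 := ltW lambda_gt0.
apply: addr_ge0; last by rewrite mulr_ge0// sqr_ge0.
by apply: mulr_ge0; [exact: mulr_ge0|exact: sumr_ge0].
Qed.

Let gap_Lfun1 r : admissible X r -> sqdev P (loss X r) \in Lfun P 1 ->
  gap r \in Lfun P 1.
Proof.
move=> adr sqL; rewrite gapE.
apply: Lfun1D; first by apply: Lfun1B; exact: cost_Lfun1.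
by apply/Lfun1Z/Lfun1B; [exact: loss_Lfun1|exact: Lfun1_cst].
Qed.

Let mean_gap r : admissible X r -> sqdev P (loss X r) \in Lfun P 1 ->
  mean P (gap r) =
  mean P (cost X beta lambda r) - mean P (cost X beta lambda rs).
Proof.
move=> adr sqL; rewrite gapE.
have cL r' := @cost_Lfun1 _ _ _ P n X beta lambda X_L1 r'.
have lL : (fun w => Y w - sigma) \in Lfun P 1.
  by apply: Lfun1B; [exact: loss_Lfun1|exact: Lfun1_cst].
rewrite meanD; [|by apply: Lfun1B; exact: cL|exact: Lfun1Z].
rewrite meanB; [|exact: cL..].
rewrite meanZ// meanB; [|exact: loss_Lfun1|exact: Lfun1_cst].
by rewrite sigmaE mean_cst subrr mulr0 addr0.
Qed.

Lemma cession_minimizer : minimizers X beta lambda rs.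
Proof.
split=> // r adr; rewrite (objectiveE _ _ X_L1 rs_adm)//.
have [sqL|sqL] := boolP (sqdev P (loss X r) \in Lfun P 1); last first.
  by rewrite (objective_pinfty _ X_L1)// leey.
rewrite (objectiveE _ _ X_L1 adr)// lee_fin -subr_ge0 -mean_gap//.
by apply: mean_ae_ge0; [exact/Lfun1_measurable/gap_Lfun1|exact: gap_ae_ge0].
Qed.

(** The objective of [rs] is finite, so a minimizer has integrable squared deviation, and its
    nonnegative [gap] has mean at most 0. *)
Let minimizer_gap r : minimizers X beta lambda r ->
  {ae P, forall w, gap r w = 0}.
Proof.
move=> [adr /(_ _ rs_adm)]; rewrite (objectiveE _ _ X_L1 rs_adm)//.
have [sqL|sqL] := boolP (sqdev P (loss X r) \in Lfun P 1); last first.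
  by rewrite (objective_pinfty _ X_L1).
rewrite (objectiveE _ _ X_L1 adr)// lee_fin -subr_le0 -mean_gap// => gap_le0.
have gL := gap_Lfun1 adr sqL; have mg := Lfun1_measurable gL.
apply: expectation_ae_eq0 => //; first exact: gap_ae_ge0.
rewrite -meanK//; congr EFin; apply/eqP; rewrite eq_le gap_le0.
by apply: mean_ae_ge0 => //; exact: gap_ae_ge0.
Qed.

Lemma minimizer_cession r : minimizers X beta lambda r ->
  forall i, {ae P, forall w, r i w = rs i w}.
Proof.
move=> rmin; have adr := rmin.1.
pose c := mean P (loss X r) - sigma.
have eqs : {ae P, forall w,
    (forall i, slack r i w = 0) /\ loss X r w = Y w + c}.
  apply: filterS2 (slack_ae_ge0 adr) (minimizer_gap rmin) => w s0 /eqP.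
  rewrite paddr_eq0; first last.
  - by rewrite mulr_ge0 ?sqr_ge0// ltW.
  - by apply: mulr_ge0; [rewrite mulr_ge0// ltW|exact: sumr_ge0].
  have l2 : 0 < 2 * lambda by exact: mulr_gt0.
  move=> /andP[]; rewrite mulf_eq0 (gt_eqF l2)/= psumr_eq0// => /allP s00.
  rewrite mulf_eq0 (gt_eqF lambda_gt0)/= sqrf_eq0 => /eqP lY; split.
    by move=> i; apply/eqP/s00; rewrite mem_index_enum.
  by rewrite /c; lra.
have lossB w : loss X r w - Y w = - \sum_i (r i w - rs i w).
  by rewrite /Y /loss -sumrB -sumrN; apply: eq_bigr => i _; ring.
have slack0 w i : slack r i w = 0 -> Y w != b i -> r i w = rs i w.
  move=> /eqP; rewrite mulf_eq0 subr_eq0 [in _ || _]subr_eq0 eq_sym.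
  by rewrite [b i == _]eq_sym => /orP[/eqP ->//|->].
have c0 : c = 0.
  apply/eqP/negPn/negP => c_neq0.
  (* The smallest deductible: once [Y] is almost surely some [b i], it is at least [b0], and so is
     its mean. *)
  pose b0 := b (Ordinal n_gt0).
  suff : b0 <= mean P Y by rewrite sigmaE leNgt lt_sigma_b.
  rewrite -[b0](mean_cst P); apply: mean_ae_le.
  - exact: Lfun1_cst.
  - exact: loss_Lfun1.
  apply: filterS eqs => w [sl lY].
  have [[i /eqP Yi]|Yn] := pselect (exists i, Y w == b i).
    rewrite Yi; have [i0|i0] := posnP i; last exact/ltW/b_incr.
    by rewrite /b0 (_ : Ordinal n_gt0 = i)//; apply: val_inj.
  (* Where [Y] is no deductible, all cessions agree, so the losses do too and [c] must be 0. *)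
  case/eqP: c_neq0; have := lossB w; rewrite lY addrAC subrr add0r => ->.
  rewrite big1 ?oppr0// => i _; rewrite (slack0 w i) ?subrr//.
  by apply: contra_notN Yn => Yi; exists i.
move=> i; apply: filterS eqs => w [sl]; rewrite c0 addr0 => lY.
(* If [Y w = b i], no other deductible equals [Y w]; the other cessions agree, and equality of the
   losses settles risk [i]. *)
have [Yi|] := eqVneq (Y w) (b i); last exact: slack0.
have := lossB w; rewrite lY subrr => /eqP.
rewrite eq_sym oppr_eq0 (bigD1 i)//= big1 ?addr0 ?subr_eq0; first by move/eqP.
move=> j ji; rewrite (slack0 w j) ?subrr// Yi.
apply: contra_neqN ji => /eqP bij; apply/val_inj; apply/eqP.
have [/b_incr|/b_incr|//] := ltngtP (val j) (val i);
  by rewrite bij ltxx.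
Qed.

End Optimality.

(** * The case [lambda = 0] *)

Section FreeRetention.
Context {d : measure_display} {T : measurableType d} {R : realType}.
Variables (P : probability T R) (n : nat) (X : 'I_n -> {RV P >-> R}).
Variables (beta : 'I_n -> R).
Hypothesis X_L1 : forall i, (X i : T -> R) \in Lfun P 1.
Hypothesis X_ge0 : forall i, {ae P, forall w, 0 <= X i w}.
Hypothesis beta_gt0 : forall i, 0 < beta i.

Let r0 (i : 'I_n) : {RV P >-> R} := cst 0.

Let objective0 (r : 'I_n -> {RV P >-> R}) : admissible X r ->
  objective X beta 0 r = (mean P (fun w => \sum_i beta i * r i w))%:E.
(* The variance term is 0 even when the variance is infinite. *)
Proof. by move=> adr; rewrite /objective mul0e adde0 (premiumE _ X_L1). Qed.

Let r0_adm : admissible X r0.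
Proof. by move=> i; apply: filterS (X_ge0 i) => w; rewrite lexx. Qed.

Let r0_objective : objective X beta 0 r0 = 0%E.
Proof.
rewrite objective0// (_ : (fun w => _) = fun=> 0) ?mean_cst//.
by apply/funext => w; rewrite big1// => i _; rewrite mulr0.
Qed.

Let premium_ae_ge0 r : admissible X r ->
  {ae P, forall w, forall i, 0 <= beta i * r i w}.
Proof.
move=> adr; apply: filterS (filter_forall _ adr) => w r0w i.
by rewrite mulr_ge0 ?(ltW (beta_gt0 _))//; case/andP: (r0w i).
Qed.

(** Only the premium is left, and ceding nothing makes it 0. A minimizer thus has a nonnegative
    premium of mean 0, and the loadings are positive. *)
Lemma minimizers_lambda0 r : minimizers X beta 0 r <->
  forall i, {ae P, forall w, r i w = 0}.
Proof.
split=> [[adr /(_ _ r0_adm)]|r_eq0].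
  rewrite r0_objective objective0// => mr i.
  have rL := premium_Lfun1 beta X_L1 adr; have mrL := Lfun1_measurable rL.
  have s0 : {ae P, forall w, 0 <= \sum_i beta i * r i w}.
    by apply: filterS (premium_ae_ge0 adr) => w rw; exact: sumr_ge0.
  have Er0 : ('E_P[fun w => (\sum_i beta i * r i w)%R] = 0)%E.
    rewrite -meanK//; apply/eqP; rewrite eq_le mr lee_fin.
    exact: mean_ae_ge0.
  apply: filterS2 (premium_ae_ge0 adr) (expectation_ae_eq0 mrL s0 Er0) => w rw.
  move=> /eqP; rewrite psumr_eq0// => /allP/(_ i (mem_index_enum _))/=.
  by rewrite mulf_eq0 gt_eqF//= => /eqP.
have adr : admissible X r := admissible_ae_eq (r' := r0) r_eq0 r0_adm.
split=> // r' adr'; rewrite (objective_ae_eq X beta 0 (r' := r0) r_eq0).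
rewrite r0_objective objective0// lee_fin; apply: mean_ae_ge0.
  exact/Lfun1_measurable/premium_Lfun1.
by apply: filterS (premium_ae_ge0 adr') => w rw; exact: sumr_ge0.
Qed.

Lemma layer_lambda0 sigma k :
  {ae P, forall w, 0%:E = layer X beta 0 sigma k w}.
Proof.
(* Here [beta k / 0 = +oo], so the positive part is 0 whatever [sigma] is. *)
apply: filterS (X_ge0 k) => w X0; rewrite /layer mulr0 inve0.
rewrite gt0_muley ?lte_fin// addeC /= addeNy /maxe ltNy0.
by rewrite -EFin_min min_l.
Qed.

End FreeRetention.

(** * Extended-real layers as real cessions, and the two cases of [lambda] *)

Lemma layer_cession (d : measure_display) (T : measurableType d)
    (R : realType) (P : probability T R) (n : nat) (X : 'I_n -> {RV P >-> R})
    (beta : 'I_n -> R) (lambda sigma : R) (k : 'I_n) (w : T) : 0 < lambda ->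
  layer X beta lambda sigma k w =
  (cession (X ^~ w) (fun i => beta i / (2 * lambda) + sigma) k)%:E.
Proof.
move=> l0; rewrite /layer inver gt_eqF ?mulr_gt0//.
by rewrite -EFinM -!EFinB -EFin_max -EFin_min -addrA -opprD.
Qed.

Theorem theorem2 (d : measure_display) (Omega : measurableType d)
    (R : realType) (P : probability Omega R) (n : nat)
    (X : 'I_n -> {RV P >-> R}) (beta : 'I_n -> R) (lambda : R)
    (n_gt0 : (0 < n)%N)
    (X_L1 : forall i, (X i : Omega -> R) \in Lfun P 1)
    (X_ge0 : forall i, {ae P, forall w, 0 <= X i w})
    (beta_gt0 : forall i, 0 < beta i)
    (beta_incr : forall i j : 'I_n, (i < j)%N -> beta i < beta j)
    (lambda_ge0 : 0 <= lambda) :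
  exists rstar : 'I_n -> {RV P >-> R},
    (forall r : 'I_n -> {RV P >-> R},
       minimizers X beta lambda r <->
       forall i, {ae P, forall w, r i w = rstar i w}) /\
    exists sigma : R, forall k : 'I_n,
      {ae P, forall w, (rstar k w)%:E = layer X beta lambda sigma k w}.
Proof.
move: lambda_ge0; rewrite le_eqVlt => /predU1P[<-|lambda_gt0].
  exists (fun=> cst 0); split; first by move=> r; exact: minimizers_lambda0.
  by exists 0 => k; exact: layer_lambda0.
have [sigma sigma_ge0 sigmaE] :=
  mean_retention_fixpoint X_L1 X_ge0 (fun i => beta i / (2 * lambda)).
pose rs := cession_rv X (fun i => beta i / (2 * lambda) + sigma).
exists rs; split; last first.
  by exists sigma => k; apply: aeW => w; rewrite layer_cession.
(* [retention_rv] and [loss X rs] are convertible, so [sigmaE] is the required condition on the mean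
   loss. *)
have rsmin : minimizers X beta lambda rs by exact: cession_minimizer.
move=> r; split; first exact: minimizer_cession.
(* Conversely, admissibility and the objective are unchanged under almost sure equality. *)
move=> rrs; split; first exact: admissible_ae_eq rrs rsmin.1.
by move=> r' adr'; rewrite (objective_ae_eq X beta lambda rrs); exact: rsmin.2.
Qed.
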